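(* Let $A$ be a regular system of divisors and $n>1$ an integer. Then for every complex $x$ with $|x|<1$, \[ \Phi_{A,n}(x)=\exp\left(-\sum_{k=1}^\infty\frac{c_{A,n}(k)}{k}x^k\right). \]
   Context: A regular system of divisors is a family $A=(A(n))_{n\in\mathbb N}$, where each $A(n)$ is a set of positive divisors of $n$, such that: (i) $A(1)=\{1\}$ and $A(mn)=\{de: d\in A(m), e\in A(n)\}$ whenever $\gcd(m,n)=1$; (ii) for every prime power $p^a$ ($a\ge1$) there is a divisor $t=t_A(p^a)$ of $a$ such that $A(p^{it})=\{1,p^t,\dots,p^{it}\}$ for every $0\le i\le a/t$. For $j\in\mathbb Z$, $(j,n)_A=\max\{d\in\mathbb N: d\mid j,\ d\in A(n)\}$; $\zeta_n=e^{2\pi i/n}$; $\Phi_{A,n}(x)=\prod_{1\le j\le n,\ (j,n)_A=1}(x-\zeta_n^j)$; the generalized Ramanujan sum is $c_{A,n}(k)=\sum_{1\le j\le n,\ (j,n)_A=1}\zeta_n^{jk}$. *)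

(* Defs.v *)
From mathcomp Require Import all_boot all_order all_algebra.
From mathcomp Require Import complex.
From mathcomp Require Import all_classical all_reals all_analysis.

Set Implicit Arguments.
Unset Strict Implicit.
Unset Printing Implicit Defensive.

Import Order.TTheory GRing.Theory Num.Theory.
Import numFieldNormedType.Exports.

Local Open Scope classical_set_scope.
Local Open Scope complex_scope.
Local Open Scope ring_scope.

(* [A n] is only meaningful for [0 < n]; the value [A 0] is unconstrained. *)
Record regular_divisor_system (A : nat -> set nat) : Prop := {
  rds_dvd : forall n : nat, (0 < n)%N -> A n `<=` [set d | (d %| n)%N];
  rds_one : A 1%N = [set 1%N];
  rds_mul : forall m n : nat, (0 < m)%N -> (0 < n)%N -> coprime m n ->
    A (m * n)%N = [set (d * e)%N | d in A m & e in A n];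
  rds_pow : forall p a : nat, prime p -> (0 < a)%N ->
    exists t : nat, (t %| a)%N /\
      forall i : nat, (i <= a %/ t)%N ->
        A (p ^ (i * t))%N = [set (p ^ (j * t))%N | j in [set j | (j <= i)%N]]
}.

(* The maximum is taken over [divisors n], which contains [A n] for [0 < n]
   by [rds_dvd]. *)
Definition gcdA (A : nat -> set nat) (j : int) (n : nat) : nat :=
  \max_(d <- divisors n | (d%:Z %| j)%Z && (d \in A n)) d.

Definition Cexp (R : realType) (z : R[i]) : R[i] :=
  (expR (complex.Re z))%:C * (cos (complex.Im z) +i* sin (complex.Im z)).

Definition zeta (R : realType) (n : nat) : R[i] :=
  Cexp (0 +i* (2 * pi / n%:R)).

Definition PhiA (R : realType) (A : nat -> set nat) (n : nat) : {poly R[i]} :=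
  \prod_(1 <= j < n.+1 | gcdA A j n == 1%N) ('X - (zeta R n ^+ j)%:P).

Definition ramanujan_sum (R : realType) (A : nat -> set nat) (n k : nat) :
    R[i] :=
  \sum_(1 <= j < n.+1 | gcdA A j n == 1%N) zeta R n ^+ (j * k).

(* The topology used for convergence is the one of the complex modulus: it is
   attached to the regular module [R[i]^o], since [R[i]] itself is registered
   as a module over [R]. *)
Definition log_partial_sum (R : realType) (A : nat -> set nat) (n : nat)
    (x : R[i]) : nat -> R[i]^o :=
  fun N => \sum_(1 <= k < N.+1) ramanujan_sum R A n k / k%:R * x ^+ k.

(* Main.v *)
(** Since [n] belongs to [A n], the index [j = n] does not contribute, and the
    remaining indices are stable under [j |-> n - j]; hence [PhiA] evaluated at
    [x] is the product of the factors [1 - zeta ^ j * x]. Each factor is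
    [exp (- sum_k z ^ k / k)] for [z = zeta ^ j * x]: along the ray [t z],
    [0 <= t <= 1], the function [exp (sum_k (t z) ^ k / k) * (1 - t z)] has
    derivative [0], which is checked on real and imaginary parts by termwise
    differentiation of real power series. Summing over [j] turns the logarithms
    into the series of generalized Ramanujan sums. *)
Require Import Defs.
From mathcomp Require Import all_boot all_order all_algebra.
From mathcomp Require Import complex.
From mathcomp Require Import all_classical all_reals all_analysis.
From mathcomp Require Import ring lra.
Import Order.TTheory GRing.Theory Num.Theory.
Import numFieldNormedType.Exports.

Local Open Scope classical_set_scope.
Local Open Scope complex_scope.
Local Open Scope ring_scope.

(** * Regular divisor systems: the index [n] and the symmetry of the index set *)

(** Strong induction on [n], splitting off the full power of its least prime factor. On a prime
    power [p ^ a], taking [i = a %/ t] in [rds_pow] puts [p ^ a] itself at the top of the chain;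
    coprime multiplicativity then recombines the two parts. *)
Lemma rds_self {A : nat -> set nat} {n : nat} :
  regular_divisor_system A -> (0 < n)%N -> A n n.
Proof.
move=> hA; elim/ltn_ind: n => n IH n0.
have [n1|n1] := leqP n 1.
  have -> : n = 1%N by apply/eqP; rewrite eqn_leq n1.
  by rewrite rds_one.
pose p := pdiv n; have pp : prime p by exact: pdiv_prime.
have pn : (p %| n)%N by exact: pdiv_dvd.
have l0 : (0 < logn p n)%N by rewrite logn_gt0 mem_primes pp n0.
have n'0 : (0 < n`_p^')%N by exact: part_gt0.
have pl : (1 < p ^ logn p n)%N by rewrite -(expn0 p) ltn_exp2l ?prime_gt1.
have np : n = (p ^ logn p n * n`_p^')%N by rewrite -p_part partnC.
have cop : coprime (p ^ logn p n) (n`_p^')%N by rewrite -p_part coprime_partC.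
rewrite [X in A X _]np [X in _ X]np (rds_mul hA (ltnW pl) n'0 cop).
exists (p ^ logn p n)%N; last first.
  exists (n`_p^')%N => //; apply: IH => //.
  by rewrite [ltnRHS]np -[ltnLHS]mul1n ltn_pmul2r.
have [t [ta /(_ _ (leqnn _))]] := rds_pow hA pp l0.
by rewrite divnK// => ->; exists (logn p n %/ t)%N => //=; rewrite divnK.
Qed.

Lemma gcdA_nn {A : nat -> set nat} {n : nat} :
  regular_divisor_system A -> (0 < n)%N -> (n <= gcdA A n n)%N.
Proof.
move=> hA n0; rewrite /gcdA; apply: (leq_bigmax_seq (F := id) n).
  by rewrite -dvdn_divisors.
by rewrite dvdzz/= mem_set//; exact: rds_self.
Qed.

(** Only divisors [d] of [n] compete in the maximum, and such a [d] divides [n - j] exactly when it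
    divides [j]. *)
Lemma gcdA_sub (A : nat -> set nat) {n j : nat} : (j <= n)%N ->
  gcdA A (n - j)%N n = gcdA A j n.
Proof.
move=> jn; have [n0|n0] := posnP n.
  by move: jn; rewrite n0 leqn0 => /eqP ->.
rewrite /gcdA big_seq_cond [RHS]big_seq_cond; apply: eq_bigl => d.
rewrite -dvdn_divisors//; have [dn|//] := boolP (d %| n)%N.
by rewrite !dvdzE /= dvdn_subr.
Qed.

(** * The complex exponential, roots of unity and the reversed product *)

Lemma Cexp0 (R : realType) : Cexp (0 : R[i]) = 1.
Proof. by rewrite /Cexp /= expR0 cos0 sin0 mul1r. Qed.

Lemma CexpD (R : realType) (z w : R[i]) : Cexp (z + w) = Cexp z * Cexp w.
Proof.
case: z w => [a b] [c d]; rewrite /Cexp /= expRD cosD sinD.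
by apply/eqP; rewrite eq_complex /=; apply/andP; split; apply/eqP; ring.
Qed.

Lemma Cexp_sum (R : realType) (I : Type) (r : seq I) (P : pred I)
    (F : I -> R[i]) :
  Cexp (\sum_(i <- r | P i) F i) = \prod_(i <- r | P i) Cexp (F i).
Proof. by apply: big_morph; [exact: CexpD|exact: Cexp0]. Qed.

Lemma CexpX (R : realType) (z : R[i]) (k : nat) : Cexp z ^+ k = Cexp (z *+ k).
Proof. by elim: k => [|k IH]; rewrite ?Cexp0// exprS IH mulrS CexpD. Qed.

Lemma complexMn (R : realType) (a b : R) (k : nat) :
  (a +i* b) *+ k = (a *+ k) +i* (b *+ k).
Proof. by elim: k => [//|k IH]; rewrite !mulrS IH. Qed.

Lemma zetaX (R : realType) (n k : nat) :
  zeta R n ^+ k = Cexp (0 +i* (2 * pi / n%:R *+ k)).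
Proof. by rewrite CexpX complexMn mul0rn. Qed.

Lemma zeta_expn (R : realType) {n : nat} : (0 < n)%N -> zeta R n ^+ n = 1.
Proof.
move=> n0; rewrite zetaX -(mulr_natr (_ / _)) divfK ?pnatr_eq0 -?lt0n//.
by rewrite /Cexp /= expR0 mulr_natl cos2pi sin2pi mul1r.
Qed.

Lemma norm_zetaX (R : realType) (n k : nat) : `|zeta R n ^+ k| = 1.
Proof. by rewrite zetaX /Cexp /= expR0 mul1r normc_def /= cos2Dsin2 sqrtr1. Qed.

(** The real part already differs from 1: it is [cos (2 s) = 1 - 2 sin s ^ 2] with [s = pi * j / n]
    strictly between 0 and [pi], where the sine is positive. *)
Lemma zetaX_neq1 (R : realType) {n j : nat} :
  (0 < j < n)%N -> zeta R n ^+ j != 1.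
Proof.
move=> /andP[j0 jn]; have n0 : (0 < n)%N := ltn_trans j0 jn.
rewrite zetaX /Cexp /= expR0 mul1r; apply/eqP => -[]/=.
set t := (X in cos X) => cost _.
have pi0 := @pi_gt0 R.
have tE : t = (pi * (j%:R / n%:R)) *+ 2.
  by rewrite /t -(mulr_natr (_ / _)) -(mulr_natr (_ * _)); ring.
have q0 : 0 < j%:R / n%:R :> R by rewrite divr_gt0 ?ltr0n.
have q1 : j%:R / n%:R < 1 :> R by rewrite ltr_pdivrMr ?ltr0n// mul1r ltr_nat.
have s0 : 0 < sin (pi * (j%:R / n%:R) : R).
  by apply: sin_gt0_pi; rewrite pmulr_rgt0// q0/= gtr_pMr.
move: cost; rewrite tE cos_mulr2n cos2sin2 => cost.
have : sin (pi * (j%:R / n%:R) : R) ^+ 2 = 0 by lra.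
by move/eqP; rewrite sqrf_eq0 gt_eqF.
Qed.

(* The index set is stable under j |-> n - j, so reversing each factor gives
   the product on the right up to a constant, which the nonzero value at
   x = 1 shows to be 1. *)
Lemma horner_PhiA (R : realType) (A : nat -> set nat) (n : nat) (x : R[i]) :
  regular_divisor_system A -> (1 < n)%N ->
  (PhiA R A n).[x] =
  \prod_(1 <= j < n.+1 | gcdA A j n == 1%N) (1 - zeta R n ^+ j * x).
Proof.
move=> hA n1; have n0 : (0 < n)%N by exact: ltnW.
have nN : gcdA A n n == 1%N = false.
  by apply/eqP => h; have := gcdA_nn hA n0; rewrite h leqNgt n1.
rewrite /PhiA horner_prod big_mkcond [RHS]big_mkcond.
rewrite !big_nat_recr//= nN !mulr1 -!big_mkcond/=.
under eq_bigr do rewrite hornerXsubC.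
pose c : R[i] := \prod_(1 <= j < n | gcdA A j n == 1%N) - zeta R n ^+ j.
have H y : \prod_(1 <= j < n | gcdA A j n == 1%N) (y - zeta R n ^+ j) =
    c * \prod_(1 <= j < n | gcdA A j n == 1%N) (1 - zeta R n ^+ j * y).
  rewrite [X in c * X]big_nat_rev/= add1n.
  have -> : \prod_(1 <= j < n | gcdA A (n.+1 - j.+1)%N n == 1%N)
      (1 - zeta R n ^+ (n.+1 - j.+1) * y) =
      \prod_(1 <= j < n | gcdA A j n == 1%N) (1 - zeta R n ^+ (n - j) * y).
    rewrite big_nat_cond [RHS]big_nat_cond; apply: eq_bigl => j.
    have [/andP[_ /ltnW jn]|//] := boolP (1 <= j < n)%N.
    by rewrite subSS gcdA_sub.
  rewrite -big_split/= big_nat_cond [RHS]big_nat_cond.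
  apply: eq_bigr => j /andP[/andP[_ /ltnW jn] _].
  (* Since [zeta ^ j * zeta ^ (n - j) = 1], multiplying [1 - zeta ^ (n - j) * y] by [- zeta ^ j]
     gives [y - zeta ^ j]. *)
  rewrite mulrBr mulr1 mulrA mulNr -exprD subnKC// zeta_expn//.
  by rewrite mulNr mul1r opprK addrC.
suff c1 : c = 1 by rewrite H c1 mul1r.
have := H 1; under [X in c * X]eq_bigr do rewrite mulr1.
rewrite -{1}[X in X = _]mul1r => /mulIf -> //.
rewrite prodf_seq_neq0; apply/allP => j; rewrite mem_index_iota => hj.
by apply/implyP => _; rewrite subr_eq0 eq_sym zetaX_neq1.
Qed.

(** * Termwise differentiation of real power series *)

(** Absorbs the factor [i.+1] created by differentiation into a slightly larger radius [b], at the
    cost of the constant [b - a]. *)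
Lemma mulrn_exprn_le (R : realDomainType) (a b : R) (i : nat) :
  0 <= a <= b -> i.+1%:R * a ^+ i * (b - a) <= b ^+ i.+1.
Proof.
move=> /andP[a0 ab]; elim: i => [|i IH]; first by rewrite expr0 expr1; lra.
have b0 : 0 <= b by exact: le_trans ab.
have le1 : a ^+ i.+1 <= b ^+ i.+1 by rewrite lerXn2r// nnegrE.
have -> : i.+2%:R * a ^+ i.+1 * (b - a) =
    a * (i.+1%:R * a ^+ i * (b - a)) + (b - a) * a ^+ i.+1.
  by rewrite -natr1 [a ^+ i.+1]exprS; ring.
have -> : b ^+ i.+2 = a * b ^+ i.+1 + (b - a) * b ^+ i.+1.
  by rewrite [LHS]exprS; ring.
by apply: lerD; apply: ler_wpM2l => //; rewrite subr_ge0.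
Qed.

Lemma is_cvg_pseries_diffs {R : realType} {f : nat -> R} {x z : R} :
  cvgn (pseries f x) -> `|z| < `|x| -> cvgn (pseries (pseries_diffs f) z).
Proof.
move=> cfx zx; pose y : R := (`|z| + `|x|) / 2.
have zy : `|z| < y by rewrite /y; lra.
have yx : y < `|x| by rewrite /y; lra.
have y0 : 0 <= y by rewrite (le_trans _ (ltW zy)).
have := @is_cvg_pseries_inside_norm _ f x y cfx; rewrite ger0_norm// => /(_ yx).
rewrite /pseries => cfy.
(* The differentiated series pairs [f i.+1] with index [i], so the term of index 0 is dropped and
   the rest shifted. *)
have {}cfy : cvgn (series (fun i => `|f i.+1| * y ^+ i.+1)).
  have -> : series (fun i => `|f i.+1| * y ^+ i.+1) =
      [sequence (fun k => \sum_(1 <= i < k) `|f i| * y ^+ i) n.+1]_n.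
    by apply/funext => k; rewrite /series/= big_add1.
  move: cfy; rewrite -(is_cvg_series_restrict 1) => /cvg_ex[l cl].
  by apply/cvg_ex; exists l; move: cl; rewrite -cvg_shiftS.
apply: normed_cvg.
(* The constant [(y - |z|)^-1] comes from [mulrn_exprn_le] with [a = |z|] and [b = y]. *)
apply: (@series_le_cvg _ _ ((y - `|z|)^-1 *: (fun i => `|f i.+1| * y ^+ i.+1))).
- by move=> n /=.
- move=> n /=; rewrite mulr_ge0// ?invr_ge0 ?subr_ge0 ?(ltW zy)//.
  by rewrite mulr_ge0// exprn_ge0.
- move=> n /=; rewrite /pseries_diffs !normrM normrX.
  rewrite ger0_norm// [leRHS]mulrC ler_pdivlMr ?subr_gt0//.
  have := @mulrn_exprn_le _ `|z| y n; rewrite normr_ge0 (ltW zy) => /(_ isT) h.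
  have -> : n.+1%:R * `|f n.+1| * `|z| ^+ n * (y - `|z|) =
    `|f n.+1| * (n.+1%:R * `|z| ^+ n * (y - `|z|)) by ring.
  exact: ler_wpM2l.
- exact: is_cvg_seriesZ.
Qed.

(** [pseries_snd_diffs] asks for convergence of the series and of its first two formal derivatives
    at one point beyond [x]. Each formal derivative costs a strict decrease of the radius, hence the
    nested midpoints [K1] and [K2]. *)
Lemma is_derive_pseries {R : realType} {f : nat -> R} {K x : R} :
  cvgn (pseries f K) -> `|x| < `|K| ->
  is_derive x 1 (fun t => limn (pseries f t))
    (limn (pseries (pseries_diffs f) x)).
Proof.
move=> cfK xK; pose K1 : R := (`|x| + `|K|) / 2; pose K2 : R := (`|x| + K1) / 2.
have x0 : 0 <= `|x| by [].
have K10 : 0 <= K1 by rewrite /K1; lra.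
have K20 : 0 <= K2 by rewrite /K2; lra.
have K1K : `|K1| < `|K| by rewrite ger0_norm// /K1; lra.
have K21 : `|K2| < `|K1| by rewrite !ger0_norm// /K2 /K1; lra.
have c1 := is_cvg_pseries_diffs cfK K1K.
apply: (@pseries_snd_diffs _ _ K2).
- by apply: is_cvg_pseries_inside cfK _; exact: lt_trans K1K.
- exact: is_cvg_pseries_inside c1 _.
- exact: is_cvg_pseries_diffs c1 _.
- by rewrite (ger0_norm K20) /K2 /K1; lra.
Qed.

Lemma is_cvg_pseries_geometric {R : realType} {f : nat -> R} (r : R) {x : R} :
  (forall k, `|f k| <= r ^+ k) -> `|r * x| < 1 -> cvgn (pseries f x).
Proof.
move=> fr rx; apply: normed_cvg.
apply: (@series_le_cvg _ _ (geometric 1 `|r * x|)) => [k|k|k|] /=.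
- by [].
- by rewrite mul1r exprn_ge0.
- rewrite mul1r !normrM exprMn normrX ler_wpM2r ?exprn_ge0//.
  by rewrite (le_trans (fr k))// -normrX ler_norm.
- by apply: is_cvg_geometric_series; rewrite normr_id.
Qed.

(** * Real and imaginary parts, and convergence in the complex modulus *)

Lemma norm_Re_le (R : realType) (z : R[i]) : `|complex.Re z| <= complex.Re `|z|.
Proof. by have := normc_ge_Re z; rewrite lecE /= => /andP[]. Qed.

Lemma norm_Im_le (R : realType) (z : R[i]) : `|complex.Im z| <= complex.Re `|z|.
Proof.
by case: z => a b; rewrite normc_def /= -sqrtr_sqr ler_wsqrtr// lerDr sqr_ge0.
Qed.

Lemma ReD (R : realType) (z w : R[i]) :
  complex.Re (z + w) = complex.Re z + complex.Re w.
Proof. by case: z w => [a b] [c d]. Qed.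

Lemma ImD (R : realType) (z w : R[i]) :
  complex.Im (z + w) = complex.Im z + complex.Im w.
Proof. by case: z w => [a b] [c d]. Qed.

Lemma Re_sum (R : realType) (I : Type) (r : seq I) (P : pred I) (F : I -> R[i]) :
  complex.Re (\sum_(i <- r | P i) F i) = \sum_(i <- r | P i) complex.Re (F i).
Proof. by apply: big_morph; [exact: ReD|]. Qed.

Lemma Im_sum (R : realType) (I : Type) (r : seq I) (P : pred I) (F : I -> R[i]) :
  complex.Im (\sum_(i <- r | P i) F i) = \sum_(i <- r | P i) complex.Im (F i).
Proof. by apply: big_morph; [exact: ImD|]. Qed.

Lemma ReM (R : realType) (z w : R[i]) : complex.Re (z * w) =
  complex.Re z * complex.Re w - complex.Im z * complex.Im w.
Proof. by case: z w => [a b] [c d]. Qed.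

Lemma ImM (R : realType) (z w : R[i]) : complex.Im (z * w) =
  complex.Re z * complex.Im w + complex.Im z * complex.Re w.
Proof. by case: z w => [a b] [c d]. Qed.

Lemma norm_complexE (R : realType) (z : R[i]) : `|z| = (complex.Re `|z|)%:C.
Proof. by rewrite normc_def. Qed.

Lemma Re_normX (R : realType) (z : R[i]) (k : nat) :
  complex.Re `|z ^+ k| = complex.Re `|z| ^+ k.
Proof.
apply: complexI; rewrite -norm_complexE normrX norm_complexE.
by rewrite -rmorphXn.
Qed.

Lemma cvg_complex (R : realType) (u : nat -> R[i]^o) (a b : R) :
  (fun k => complex.Re (u k)) @ \oo --> a ->
  (fun k => complex.Im (u k)) @ \oo --> b ->
  u @ \oo --> (a +i* b : R[i]^o).
Proof.
move=> ua ub; apply/cvgrPdist_lt => -[e e'].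
rewrite ltcE /= => /andP[/eqP -> e0].
(* Two coordinates within [e / 2] suffice, as the sum of their squares is below [e ^ 2]. *)
have e20 : 0 < e / 2 by lra.
near=> k.
have ha : `|a - complex.Re (u k)| < e / 2.
  by near: k; move/cvgrPdist_lt : ua; exact.
have hb : `|b - complex.Im (u k)| < e / 2.
  by near: k; move/cvgrPdist_lt : ub; exact.
move: ha hb; case: (u k) => [c d] /= ha hb.
rewrite normc_def /= ltcR.
rewrite -(@ger0_norm _ e) ?ltW// -sqrtr_sqr ltr_sqrt ?exprn_gt0//.
rewrite -[X in X + _]real_normK ?num_real// -[X in _ + X]real_normK ?num_real//.
have := normr_ge0 (a - c); have := normr_ge0 (b - d); nra.
Unshelve. all: by end_near. Qed.

(** * The logarithm series along a ray *)

(** Peeling off the constant term turns a recursion on coefficients into an equation for the sums.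
    With [p] and [q] the real and imaginary parts of the powers of [z], this is the geometric series
    equation [s = z + t z s]. *)
Lemma lim_pseries_rec {R : realType} (a b : R) (p q : nat -> R) (t : R) :
  (forall k, p k.+1 = a * p k - b * q k) ->
  cvgn (pseries p t) -> cvgn (pseries q t) ->
  limn (pseries p t) =
  p 0%N + t * (a * limn (pseries p t) - b * limn (pseries q t)).
Proof.
move=> pS cp cq.
apply/cvg_lim => //; rewrite -cvg_shiftS.
have -> : [sequence pseries p t n.+1]_n =
    (fun n => p 0%N + t * (a * pseries p t n - b * pseries q t n)).
  apply/funext => n; rewrite /pseries /series /= big_nat_recl//= expr0 mulr1.
  congr (_ + _); rewrite !mulr_sumr -sumrB mulr_sumr.
  by apply: eq_bigr => i _; rewrite pS exprS; ring.
apply: cvgD; first exact: cvg_cst.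
by apply: cvgMr; apply: cvgB; apply: cvgMr.
Qed.

(* The function below is [Re (exp (u + i v) * (1 - t (a + i b)))]; the
   hypotheses on the derivatives say [(u + i v)' = z / (1 - t z)]. *)
Lemma expR_cos_cst {R : realType} {u v du dv : R -> R} {a b : R} :
  (forall t : R, 0 <= t <= 1 -> is_derive t 1 u (du t)) ->
  (forall t : R, 0 <= t <= 1 -> is_derive t 1 v (dv t)) ->
  (forall t : R, 0 <= t <= 1 -> du t = a + t * (a * du t - b * dv t)) ->
  (forall t : R, 0 <= t <= 1 -> dv t = b + t * (a * dv t + b * du t)) ->
  expR (u 1) * (cos (v 1) * (1 - a) + sin (v 1) * b) =
  expR (u 0) * cos (v 0).
Proof.
move=> u' v' ru rv.
pose H (t : R) := expR (u t) * (cos (v t) * (1 - t * a) + sin (v t) * (t * b)).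
suff : H 1 = H 0 by rewrite /H !mul1r !mul0r mulr0 addr0 subr0 mulr1.
have H' (t : R) : 0 <= t <= 1 -> is_derive t 1 H 0.
  move=> t01; have ut := u' _ t01; have vt := v' _ t01.
  have e1 := is_derive1_comp (is_derive_expR (u t)) ut.
  have e2 := is_derive1_comp (is_derive_cos (v t)) vt.
  have e3 := is_derive1_comp (is_derive_sin (v t)) vt.
  have e4 : is_derive t 1 (fun s : R => 1 - s * a) (- a).
    by apply: is_derive_eq; rewrite /GRing.scale /=; ring.
  have e5 : is_derive t 1 (fun s : R => s * b) b.
    by apply: is_derive_eq; rewrite /GRing.scale /=; ring.
  have e6 := is_deriveM e1 (is_deriveD (is_deriveM e2 e4) (is_deriveM e3 e5)).
  apply: (is_derive_eq e6); rewrite /GRing.scale /=.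
  rewrite [X in X * (_ * du t)](_ : _ =
    cos (v t) * (1 - t * a) + sin (v t) * (t * b))//.
  (* The derivative is a combination of the defects of the two equations [ru] and [rv], both of
     which vanish. *)
  transitivity (expR (u t) *
      (cos (v t) * (du t - (a + t * (a * du t - b * dv t))) -
       sin (v t) * (dv t - (b + t * (a * dv t + b * du t))))); first by ring.
  by rewrite -(ru _ t01) -(rv _ t01) !subrr !mulr0 subrr mulr0.
have [t| |c _] := @MVT R H (cst 0) 0 1 ltr01.
- by rewrite in_itv/= => /andP[? ?]; apply: H'; rewrite !ltW.
- apply: derivable_within_continuous => t; rewrite in_itv/= => /H' dt.
  exact: ex_derive.
by rewrite /= mul0r => /eqP; rewrite subr_eq0 => /eqP.
Qed.

Lemma Cexp_log_series {R : realType} (z : R[i]) : `|z| < 1 ->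
  exists2 l : R[i],
    (fun N => \sum_(1 <= k < N.+1) z ^+ k / k%:R : R[i]^o) @ \oo -->
      (l : R[i]^o) & Cexp (- l) = 1 - z.
Proof.
move=> z1; pose r := complex.Re `|z|.
have r0 : 0 <= r by rewrite /r normc_def sqrtr_ge0.
have r1 : r < 1 by move: z1; rewrite ltcE /= => /andP[].
pose a := complex.Re z; pose b := complex.Im z.
(* Real coefficients, in the variable [t], of the series of [(t z) ^ k / k]; the one of index 0
   vanishes because [0^-1 = 0]. *)
pose c (k : nat) : R := complex.Re (z ^+ k) / k%:R.
pose d (k : nat) : R := complex.Im (z ^+ k) / k%:R.
have divn_le k (x : R) : `|x| <= r ^+ k -> `|x / k%:R| <= r ^+ k.
  case: k => [|k] xr; first by rewrite invr0 mulr0 normr0 exprn_ge0.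
  rewrite normrM normfV normr_nat ler_pdivrMr ?ltr0n//.
  by rewrite (le_trans xr)// ler_peMr ?exprn_ge0// ler1n.
have cr k : `|c k| <= r ^+ k by apply: divn_le; rewrite -Re_normX norm_Re_le.
have dr k : `|d k| <= r ^+ k by apply: divn_le; rewrite -Re_normX norm_Im_le.
(* A radius beyond 1 with [r * K = 2 r / (1 + r) < 1], so that the closed interval from 0 to 1 lies
   strictly inside the domain of convergence. *)
pose K : R := 2 / (1 + r).
have K1 : 1 < K by rewrite /K ltr_pdivlMr; lra.
have rK : `|r * K| < 1.
  have K0 : 0 <= K by lra.
  by rewrite (ger0_norm (mulr_ge0 r0 K0)) /K mulrA ltr_pdivrMr; lra.
have cK := is_cvg_pseries_geometric r cr rK.
have dK := is_cvg_pseries_geometric r dr rK.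
have tK (t : R) : 0 <= t <= 1 -> `|t| < `|K|.
  by move=> /andP[t0 t1]; rewrite !ger0_norm//; lra.
have diffsE (f : nat -> R) : pseries_diffs (fun k => f k / k%:R) = f \o succn.
  by apply/funext => k; rewrite /pseries_diffs /= mulrC divfK// pnatr_eq0.
have cK' (t : R) : 0 <= t <= 1 -> cvgn (pseries (pseries_diffs c) t).
  by move=> /tK; apply: is_cvg_pseries_diffs.
have dK' (t : R) : 0 <= t <= 1 -> cvgn (pseries (pseries_diffs d) t).
  by move=> /tK; apply: is_cvg_pseries_diffs.
pose u (t : R) := limn (pseries c t); pose v (t : R) := limn (pseries d t).
pose du (t : R) := limn (pseries (pseries_diffs c) t).
pose dv (t : R) := limn (pseries (pseries_diffs d) t).
have u' (t : R) : 0 <= t <= 1 -> is_derive t 1 u (du t).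
  by move=> /tK; apply: is_derive_pseries.
have v' (t : R) : 0 <= t <= 1 -> is_derive t 1 v (dv t).
  by move=> /tK; apply: is_derive_pseries.
(* The differentiated coefficients are the parts of [z ^ k.+1], so [z ^ k.+2 = z * z ^ k.+1]
   supplies the recursion. *)
have ru (t : R) : 0 <= t <= 1 -> du t = a + t * (a * du t - b * dv t).
  move=> t01; rewrite [LHS](lim_pseries_rec a b _ _ _ _ (cK' _ t01) (dK' _ t01)).
    by congr (_ + _); rewrite diffsE /= expr1.
  by move=> k; rewrite !diffsE /= [z ^+ k.+2]exprS ReM.
have rv (t : R) : 0 <= t <= 1 -> dv t = b + t * (a * dv t + b * du t).
  move=> t01.
  rewrite [LHS](lim_pseries_rec a (- b) _ _ _ _ (dK' _ t01) (cK' _ t01)).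
    by rewrite mulNr opprK; congr (_ + _); rewrite diffsE /= expr1.
  by move=> k; rewrite !diffsE /= [z ^+ k.+2]exprS ImM mulNr opprK.
have lim0 (f : nat -> R) : f 0%N = 0 -> limn (pseries f 0) = 0.
  move=> f0; suff -> : pseries f 0 = cst 0 by exact: lim_cst.
  apply/funext => N; rewrite /pseries /series /= big1// => -[|k] _.
    by rewrite f0 mul0r.
  by rewrite expr0n mulr0.
have u0 : u 0 = 0 by apply: lim0; rewrite /c invr0 mulr0.
have v0 : v 0 = 0 by apply: lim0; rewrite /d invr0 mulr0.
exists (u 1 +i* v 1).
  have pS (f : nat -> R) N : (\sum_(1 <= k < N.+1) f k / k%:R) =
      pseries (fun k => f k / k%:R) 1 N.+1.
    rewrite /pseries /series /= [RHS]big_nat_recl//= invr0 mulr0 mul0r add0r.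
    by rewrite big_add1; apply: eq_bigr => i _; rewrite expr1n mulr1.
  have t1 : `|1| < `|K| by apply: tK; rewrite ler01 lexx.
  have VE k : (k%:R : R[i])^-1 = (k%:R^-1)%:C by rewrite fmorphV rmorph_nat.
  apply: cvg_complex.
    under eq_fun do (rewrite Re_sum; under eq_bigr do rewrite VE ReM/= mulr0 subr0).
    under eq_fun do rewrite pS.
    by have := is_cvg_pseries_inside cK t1; rewrite -cvg_shiftS.
  under eq_fun do (rewrite Im_sum; under eq_bigr do rewrite VE ImM/= mulr0 add0r).
  under eq_fun do rewrite pS.
  by have := is_cvg_pseries_inside dK t1; rewrite -cvg_shiftS.
have h1 := expR_cos_cst u' v' ru rv.
(* Lowering the angle by [pi / 2] replaces [cos v] by [sin v] and [sin v] by [- cos v], so the same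
   constancy lemma now yields the imaginary part of [exp (u + i v) * (1 - z)]. *)
have v'' (t : R) : 0 <= t <= 1 -> is_derive t 1 (fun s => v s - pi / 2) (dv t).
  by move=> /v' vt; apply: is_derive_eq; rewrite subr0.
have := expR_cos_cst u' v'' ru rv.
rewrite !cosB !sinB cos_pihalf sin_pihalf v0 u0 sin0 cos0 expR0.
rewrite !(mulr0, mulr1, mul0r, addr0, add0r, sub0r, mul1r) => h2.
move: h1; rewrite v0 u0 cos0 expR0 mulr1 => h1.
suff h : Cexp (u 1 +i* v 1) * (1 - z) = 1.
  by rewrite -[LHS]mulr1 -[X in _ * X]h mulrA -CexpD addNr Cexp0 mul1r.
rewrite (_ : z = a +i* b); last by rewrite /a /b; case: (z).
apply/eqP; rewrite eq_complex /Cexp /=; apply/andP; split; apply/eqP.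
- by rewrite -[RHS]h1; ring.
- by rewrite -[RHS]h2; ring.
Qed.

(** * Summation over the index set *)

Theorem theorem10 (R : realType) (A : nat -> set nat) (n : nat)
    (hA : regular_divisor_system A) (hn : (1 < n)%N)
    (x : R[i]) (hx : `|x| < 1) :
  cvgn (log_partial_sum A n x) /\
  (PhiA R A n).[x] = Cexp (- limn (log_partial_sum A n x)).
Proof.
have /choice[l lP] : forall j, exists l : R[i],
    ((fun N => \sum_(1 <= k < N.+1) (zeta R n ^+ j * x) ^+ k / k%:R : R[i]^o)
       @ \oo --> (l : R[i]^o)) /\ Cexp (- l) = 1 - zeta R n ^+ j * x.
  move=> j; have [|l cl el] := @Cexp_log_series R (zeta R n ^+ j * x).
    by rewrite normrM norm_zetaX mul1r.
  by exists l.
pose L : R[i] := \sum_(1 <= j < n.+1 | gcdA A j n == 1%N) l j.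
have cL : log_partial_sum A n x @ \oo --> (L : R[i]^o).
  (* For fixed [N] both sums are finite, so they are exchanged before any limit is taken; a finite
     sum of convergent sequences remains. *)
  have -> : log_partial_sum A n x =
      (fun N => \sum_(1 <= j < n.+1 | gcdA A j n == 1%N)
        (\sum_(1 <= k < N.+1) (zeta R n ^+ j * x) ^+ k / k%:R : R[i]^o)).
    apply/funext => N; rewrite exchange_big; apply: eq_bigr => k _.
    rewrite !mulr_suml; apply: eq_bigr => j _.
    by rewrite [in RHS]exprMn -exprM [RHS]mulrAC.
  apply: (cvg_big (@add_continuous R[i]^o)) => j _.
  exact: (lP j).1.
split; first by apply/cvg_ex; exists L.
rewrite (cvg_lim _ cL)// horner_PhiA// -sumrN Cexp_sum.
by apply: eq_bigr => j _; rewrite (lP j).2.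
Qed.
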